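(* Let $\mathcal{G}$ be a causal graph (a finite directed acyclic graph) on nodes $\{1,\dots,d\}$. Consider a VACA model over $\mathcal{G}$ whose encoder $q_\phi(\mathbf{Z}\mid\mathbf{X},\mathbf{A})$ is a message passing GNN. The abduction step of an observed sample $\mathbf{x}=\{x_1,\dots,x_d\}$ in VACA satisfies that, for all $i$, the posterior of $Z_i$ is independent of the subset $\{x_j\}_{j\notin\mathrm{pa}^*(i)}\subseteq\mathbf{x}$, if and only if the encoder GNN has no hidden layers.
   Context: Graph notation. $\mathcal{G}$ is a finite directed acyclic graph on $\{1,\dots,d\}$, where node $i$ corresponds to the endogenous variable $X_i$. An edge $(j,i)$ means that $j$ is a parent of $i$. $\mathrm{pa}(i)=\mathcal{N}_i$ is the set of parents (neighbors) of $i$, and $\mathrm{pa}^*(i)=\mathrm{pa}(i)\cup\{i\}$. The causal adjacency matrix is $\mathbf{A}\in\{0,1\}^{d\times d}$ with $A_{ij}=1$ if $j\in\mathrm{pa}^*(i)$ and $A_{ij}=0$ otherwise. Message passing GNN. A GNN with $L\ge1$ layers has $N_h=L-1$ hidden layers; it has no hidden layers when $L=1$. Given input features $h_i^0$ for each node $i$, layer $l=1,\dots,L$ computes, for every node $i$, $$h_i^l=f^u\big(h_i^{l-1},\,f^a(\{f^m(h_i^{l-1},h_j^{l-1};\theta_m^l): j\in\mathcal{N}_i\});\theta_u^l\big),$$ with message function $f^m$, aggregation function $f^a$ and update function $f^u$. The output for node $i$ is $h_i^L$. Dependence. Statements that an output is a function of an input, or is independent of it, are understood at the level of the message passing computation: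 $h_i^l$ is a function of exactly the inputs $h_k^0$ with $k\in D_i^l$, where $D_i^0=\{i\}$ and $D_i^l=D_i^{l-1}\cup\bigcup_{j\in\mathcal{N}_i}D_j^{l-1}$. VACA encoder and abduction. VACA over $\mathcal{G}$ has one latent variable $Z_i$ per node. Its encoder is a message passing GNN on $\mathcal{G}$ with input features $h_i^0=x_i$, whose output at node $i$ gives the parameters $\boldsymbol{\eta}^{enc}_i$ of the posterior approximation of $Z_i$, so that $q_\phi(\mathbf{Z}\mid\mathbf{x},\mathbf{A})=\prod_i q_{\phi_i}(Z_i;\boldsymbol{\eta}^{enc}_i)$. The abduction step for $\mathbf{x}$ is the computation of this posterior approximation. The posterior of $Z_i$ is independent of $x_j$ if $\boldsymbol{\eta}^{enc}_i$ is not a function of $x_j$.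
   Formalization: The ''only if'' direction is proved only for causal graphs in which some node has an ancestor outside pa*(i); without such a node (e.g. a single edge on two nodes) independence holds for every number of hidden layers. The ''if'' direction is proved for all graphs. *)

(* Defs.v *)
(* MathComp / MathComp-Analysis *)
From HB Require Import structures.
From mathcomp Require Import all_boot all_order all_algebra.
From mathcomp Require Import finmap multiset.
From mathcomp Require Import reals measure probability.

Set Implicit Arguments.
Unset Strict Implicit.
Unset Printing Implicit Defensive.
Import Order.TTheory GRing.Theory Num.Theory.

Local Open Scope ring_scope.

(* [edge j i] means that j is a parent of i.  [cycle e [::]] holds, and
   [cycle e [:: i]] is a self-loop, so acyclicity excludes every nonempty
   closed walk, self-loops included. *)
Record causal_graph (d : nat) := CausalGraph {
  edge : rel 'I_d;
  edge_acyclic : forall c : seq 'I_d, cycle edge c -> c = [::]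
}.

Definition pa d (G : causal_graph d) (i : 'I_d) : {set 'I_d} :=
  [set j | edge G j i].

Definition pa_star d (G : causal_graph d) (i : 'I_d) : {set 'I_d} :=
  i |: pa G i.

(* Layers are numbered from 1, while the fields below are indexed from 0:
   index l stands for layer l.+1, which maps features of dimension [width l]
   to features of dimension [width l.+1].  The aggregation function receives
   the multiset of the incoming messages. *)
Record mpgnn (R : realType) := MPGNN {
  nlayers : nat;
  nlayers_gt0 : (0 < nlayers)%N;
  width : nat -> nat;
  msg_width : nat -> nat;
  agg_width : nat -> nat;
  msg_param : nat -> Type;
  upd_param : nat -> Type;
  theta_m : forall l, msg_param l;
  theta_u : forall l, upd_param l;
  f_m : forall l, 'rV[R]_(width l) -> 'rV[R]_(width l) -> msg_param l ->
          'rV[R]_(msg_width l);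
  f_a : forall l, {mset 'rV[R]_(msg_width l)}%mset -> 'rV[R]_(agg_width l);
  f_u : forall l, 'rV[R]_(width l) -> 'rV[R]_(agg_width l) -> upd_param l ->
          'rV[R]_(width l.+1)
}.

Arguments width {R} _ _.
Arguments theta_m {R} _ _.
Arguments theta_u {R} _ _.
Arguments f_m {R} _ {l} _ _ _.
Arguments f_a {R} _ {l} _.
Arguments f_u {R} _ {l} _ _ _.

Definition hidden_layers (R : realType) (E : mpgnn R) : nat := (nlayers E).-1.

Fixpoint mp_feature (R : realType) d (G : causal_graph d) (E : mpgnn R)
    (x : 'I_d -> 'rV[R]_(width E 0)) (l : nat) : 'I_d -> 'rV[R]_(width E l) :=
  match l with
  | 0%N => x
  | k.+1 => fun i =>
      let h := mp_feature G x k in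
      f_u E (h i)
        (f_a E (seq_mset [seq f_m E (h i) (h j) (theta_m E k)
                         | j <- enum (pa G i)]))
        (theta_u E k)
  end.

Definition mp_output (R : realType) d (G : causal_graph d) (E : mpgnn R)
    (x : 'I_d -> 'rV[R]_(width E 0)) : 'I_d -> 'rV[R]_(width E (nlayers E)) :=
  mp_feature G x (nlayers E).

(* The nodes k whose input feature h_k^0 the feature h_i^l is a function of.
   Lemmas [mp_feature_deps] and [mp_deps_tight] below: no other input can
   influence h_i^l, and each of these inputs does for some choice of the
   message, aggregation and update functions. *)
Fixpoint mp_deps d (G : causal_graph d) (l : nat) (i : 'I_d) : {set 'I_d} :=
  match l with
  | 0%N => [set i]
  | k.+1 => mp_deps G k i :|: \bigcup_(j in pa G i) mp_deps G k j
  end.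

(* The inference side of the model: the encoder, and for each node i the
   family eta |-> q_i(Z_i; eta) of candidate posteriors of Z_i.  The prior and
   the decoder play no role in abduction. *)
Record vaca (R : realType) (d : nat) (G : causal_graph d) := Vaca {
  encoder : mpgnn R;
  latent_disp : 'I_d -> measure_display;
  latent : forall i, measurableType (latent_disp i);
  q_family : forall i, 'rV[R]_(width encoder (nlayers encoder)) ->
               probability (latent i) R
}.

Definition eta_enc (R : realType) d (G : causal_graph d) (M : vaca R G)
    (x : 'I_d -> 'rV[R]_(width (encoder M) 0)) (i : 'I_d) :=
  mp_output G x i.

(* The joint posterior factorises over the nodes, so it is given by its
   family of marginals. *)
Definition abduction (R : realType) d (G : causal_graph d) (M : vaca R G)
    (x : 'I_d -> 'rV[R]_(width (encoder M) 0)) (i : 'I_d) :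
    probability (latent M i) R :=
  q_family i (eta_enc x i).

Definition eta_enc_deps (R : realType) d (G : causal_graph d) (M : vaca R G)
    (i : 'I_d) : {set 'I_d} :=
  mp_deps G (nlayers (encoder M)) i.

(* "The posterior of Z_i is independent of x_j": eta_i^enc is not a function
   of x_j, at the level of the message passing computation. *)
Definition posterior_independent (R : realType) d (G : causal_graph d)
    (M : vaca R G) (i j : 'I_d) : Prop :=
  j \notin eta_enc_deps M i.

Definition abduction_parent_local (R : realType) d (G : causal_graph d)
    (M : vaca R G) : Prop :=
  forall i j : 'I_d, j \notin pa_star G i -> posterior_independent M i j.

(* Some node has an ancestor that is neither itself nor one of its parents.
   In a graph without such a pair no path, however long, reaches outside
   pa*(i), so that encoders of every depth are parent-local: see
   [no_indirect_ancestor_local]. *)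
Definition has_indirect_ancestor d (G : causal_graph d) : Prop :=
  exists i j : 'I_d, connect (edge G) j i /\ j \notin pa_star G i.

Lemma mp_feature_deps (R : realType) d (G : causal_graph d) (E : mpgnn R)
    (x y : 'I_d -> 'rV[R]_(width E 0)) (l : nat) (i : 'I_d) :
  (forall k, k \in mp_deps G l i -> x k = y k) ->
  mp_feature G x l i = mp_feature G y l i.
Proof.
elim: l i => [|l IHl] i /= xy; first by apply: xy; rewrite inE.
have hi : mp_feature G x l i = mp_feature G y l i.
  by apply: IHl => k ki; apply: xy; rewrite inE ki.
rewrite hi; congr (f_u E _ (f_a E (seq_mset _)) _).
apply/eq_in_map => j; rewrite mem_enum => ji; rewrite (IHl j) // => k kj.
by apply: xy; rewrite inE; apply/orP; right; apply/bigcupP; exists j.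
Qed.

Lemma abduction_deps (R : realType) d (G : causal_graph d) (M : vaca R G)
    (x y : 'I_d -> 'rV[R]_(width (encoder M) 0)) (i : 'I_d) :
  (forall k, k \in eta_enc_deps M i -> x k = y k) ->
  abduction x i = abduction y i.
Proof.
by move=> xy; rewrite /abduction /eta_enc /mp_output (mp_feature_deps xy).
Qed.

Definition sum_gnn (R : realType) (L : nat) (L_gt0 : (0 < L)%N) : mpgnn R :=
  @MPGNN R L L_gt0 (fun=> 1%N) (fun=> 1%N) (fun=> 1%N) (fun=> unit) (fun=> unit)
    (fun=> tt) (fun=> tt) (fun _ _ h _ => h)
    (fun _ m => \sum_(v <- (m : seq _)) v) (fun _ h a _ => h + a).

Lemma mp_deps_tight (R : realType) d (G : causal_graph d) (L : nat)
    (i j : 'I_d) :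
  (0 < L)%N -> j \in mp_deps G L i ->
  exists (E : mpgnn R) (x y : 'I_d -> 'rV[R]_(width E 0)),
    [/\ nlayers E = L, forall k, k != j -> x k = y k
      & mp_output G x i <> mp_output G y i].
Proof.
move=> L_gt0 jL; pose E := sum_gnn R L_gt0.
pose x (k : 'I_d) : 'rV[R]_(width E 0) := const_mx (k == j)%:R.
pose y (k : 'I_d) : 'rV[R]_(width E 0) := const_mx 0.
have hS z l k : mp_feature (E := E) G z l.+1 k =
    mp_feature (E := E) G z l k + \sum_(m in pa G k) mp_feature (E := E) G z l m.
  by rewrite /= (perm_big _ (perm_eq_seq_mset _)) big_map big_enum.
have y0 l k : mp_feature (E := E) G y l k = 0.
  elim: l k => [//|l IHl] k; rewrite hS IHl add0r big1 // => m _.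
have x_ge0 l k : 0 <= mp_feature (E := E) G x l k 0 0.
  elim: l k => [|l IHl] k; first by rewrite mxE ler0n.
  by rewrite hS mxE summxE addr_ge0 ?IHl // sumr_ge0 // => m _; exact: IHl.
have x_gt0 l k : j \in mp_deps G l k -> 0 < mp_feature (E := E) G x l k 0 0.
  elim: l k => [|l IHl] k; first by rewrite inE mxE => /eqP ->; rewrite eqxx ltr01.
  rewrite hS mxE summxE inE => /orP[/IHl ?|/bigcupP[m mk /IHl ?]].
    by rewrite ltr_wpDr // sumr_ge0 // => m _; exact: x_ge0.
  rewrite ltr_wpDl ?x_ge0 // (bigD1 m) //= ltr_wpDr //.
  by apply: sumr_ge0 => n _; exact: x_ge0.
exists E, x, y; split => // [k kj|]; first by rewrite /x /y (negbTE kj).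
move=> xy; have := congr1 (fun v : 'rV[R]_1 => v 0 0) xy.
by rewrite /mp_output y0 [RHS]mxE => /eqP; rewrite gt_eqF // x_gt0.
Qed.

Lemma no_indirect_ancestor_local (R : realType) d (G : causal_graph d)
    (M : vaca R G) :
  ~ has_indirect_ancestor G -> abduction_parent_local M.
Proof.
move=> noG i j ji; apply/negP => jD; apply: noG; exists i, j; split => //.
move: jD; rewrite /eta_enc_deps; elim: (nlayers _) {ji} i => [|l IHl] i /=.
  by rewrite inE => /eqP ->; exact: connect0.
rewrite inE => /orP[/IHl //|/bigcupP[k]]; rewrite inE => ki /IHl jk.
exact: connect_trans jk (connect1 ki).
Qed.

(* Main.v *)
(* One layer reaches exactly the nodes of pa*(i).  If a deeper encoder is
   parent-local, then grandparents are already in pa*(i); walking back along a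
   directed path, every ancestor of i is then in pa*(i). *)
Require Import Defs.
From mathcomp Require Import all_boot all_order all_algebra.
From mathcomp Require Import reals.

Lemma mp_deps1 d (G : causal_graph d) (i : 'I_d) :
  mp_deps G 1 i = pa_star G i.
Proof.
apply/setP => k; rewrite !inE; congr (_ || _); apply/bigcupP/idP.
  by case=> j; rewrite !inE => ji /eqP ->.
by move=> ki; exists k; rewrite !inE.
Qed.

(** The update step keeps a node's own previous feature, so extra layers never lose a dependence. *)
Lemma mp_deps_subset d (G : causal_graph d) (m n : nat) (i : 'I_d) :
  m <= n -> mp_deps G m i \subset mp_deps G n i.
Proof.
move=> /subnK <-; elim: (n - m) => [//|k IHk].
exact: subset_trans IHk (subsetUl _ _).
Qed.

Lemma mem_mp_deps2 d (G : causal_graph d) (i j k : 'I_d) :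
  edge G j k -> edge G k i -> j \in mp_deps G 2 i.
Proof.
(* Only the outer layer is unfolded, so that [mp_deps1] still applies to the inner one. *)
move=> jk ki; change (mp_deps G 2 i) with
  (mp_deps G 1 i :|: \bigcup_(m in pa G i) mp_deps G 1 m).
rewrite inE; apply/orP; right; apply/bigcupP; exists k; first by rewrite inE.
by rewrite mp_deps1 !inE jk orbT.
Qed.

Lemma connect_pa_star d (G : causal_graph d) (i j : 'I_d) :
  (forall k, mp_deps G 2 k \subset pa_star G k) ->
  connect (edge G) j i -> j \in pa_star G i.
Proof.
move=> G2 /connectP[p]; elim: p j => [|k p IHp] j /=.
  by move=> _ ->; rewrite !inE eqxx.
case/andP=> jk kp ip; have := IHp k kp ip.
(* Either [k] is [i] and [j] is a parent, or [j] is a grandparent through [k]. *)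
rewrite in_setU1 inE => /orP[/eqP <-|ki]; first by rewrite !inE jk orbT.
by apply: (subsetP (G2 i)); apply: mem_mp_deps2 jk ki.
Qed.

Theorem proposition3 (R : realType) (d : nat) (G : causal_graph d)
    (M : vaca R G) :
  (hidden_layers (encoder M) = 0%N -> abduction_parent_local M) /\
  (has_indirect_ancestor G ->
     (abduction_parent_local M <-> hidden_layers (encoder M) = 0%N)).
Proof.
have L_gt0 := nlayers_gt0 (encoder M).
have shallow : hidden_layers (encoder M) = 0%N -> abduction_parent_local M.
  rewrite /hidden_layers => L0 i j.
  have L1 : nlayers (encoder M) = 1%N by rewrite -(prednK L_gt0) L0.
  by rewrite /posterior_independent /eta_enc_deps L1 mp_deps1.
split=> // -[i [j [ji jNi]]]; split=> // local.
(* As the encoder has at least one layer, a hidden layer means at least two layers. *)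
apply/eqP; rewrite /hidden_layers -leqn0 -ltnS prednK // leqNgt.
apply/negP => L_ge2; case/negP: jNi; apply: connect_pa_star ji => k.
apply: subset_trans (mp_deps_subset _ _ _ _ _ L_ge2) _.
(* Parent-locality, by contraposition, bounds the dependences of the full encoder by
   [pa_star G k]. *)
by apply/subsetP => m; apply: contraLR => /local.
Qed.
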